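(* Let $\langle R,\sim\rangle$ be the Rado graph, $L\subset R$ a copy of $R$, fix a labeling of $L$ and let $\le_L$ be the corresponding order on $L$. Then for each finite coloring of the set $L$ there is a monochromatic strong reversed subtree $\mathcal S$ of the reversed tree $\langle L,\le_L\rangle$.
   Context: The Rado graph $\langle R,\sim\rangle$ is the unique countable graph such that $R^H_K\neq\emptyset$ for all finite $K\subset H\subset R$, where $R^H_K=\{v\in R\setminus H:\forall k\in K\,(v\sim k)\wedge\forall h\in H\setminus K\,(v\not\sim h)\}$; for $L\subset R$, $L^H_K=L\cap R^H_K$. A copy of $R$ is a subset whose induced subgraph is isomorphic to $R$. A labeling of a copy $L$ is a partition $\{L_n:n\in\omega\}$ of $L$ together with a bijection $(n,K)\mapsto q^{\bigcup_{i<n}L_i}_K$ from $\bigcup_n\{n\}\times P(\bigcup_{i<n}L_i)$ onto $L$ with $L_n=\{q^{\bigcup_{i<n}L_i}_K:K\subset\bigcup_{i<n}L_i\}$ and $q^{\bigcup_{i<n}L_i}_K\in L^{\bigcup_{i<n}L_i}_K$. The corresponding order is $q^{\bigcup_{i<m}L_i}_{K'}\le_L q^{\bigcup_{i<n}L_i}_{K''}$ iff $L^{\bigcup_{i<m}L_i}_{K'}\subset L^{\bigcup_{i<n}L_i}_{K''}$; $\langle L,\le_L\rangle$ is a reversed tree (a poset whose reverse is a tree) with a largest element, whose $n$-th level $\mathrm{Lev}_n(L)$ is $L_n$. A subset $\mathcal S$ of a reversed tree $T$ of height $\omega$ is a strong reversed subtree iff: (1) $\mathcal S$ has a unique largest element;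 (2) there is $\{n_k:k\in\omega\}$ with $n_0<n_1<\dots$ such that $\emptyset\ne\mathrm{Lev}_k(\mathcal S)\subset\mathrm{Lev}_{n_k}(T)$ for each $k$ (levels of $\mathcal S$ computed in the induced order); (3) if $s\in\mathrm{Lev}_k(\mathcal S)$, then for each immediate predecessor $t$ of $s$ in $T$ there is a unique $s_t\in\mathrm{Lev}_{k+1}(\mathcal S)$ with $s_t\le t$. It is monochromatic if all its elements have the same color. *)

(* Defs.v *)
From mathcomp Require Import all_boot.
From mathcomp Require Import boolp classical_sets functions cardinality.

Set Implicit Arguments.
Unset Strict Implicit.
Unset Printing Implicit Defensive.

Local Open Scope classical_set_scope.

(* L^H_K; the set R^H_K is the case L = setT. *)
Definition type_set (V : Type) (E : rel V) (L H K : set V) : set V :=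
  [set v | [/\ L v, ~ H v, forall k, K k -> E v k
             & forall h, (H `\` K) h -> ~~ E v h]].

Definition rado_graph (V : Type) (E : rel V) : Prop :=
  [/\ irreflexive E, symmetric E, countable [set: V]
    & forall H K : set V, finite_set H -> K `<=` H ->
        type_set E [set: V] H K !=set0].

Definition copy (V : Type) (E : rel V) (L : set V) : Prop :=
  exists2 f : V -> V, set_bij [set: V] L f &
    forall x y, E (f x) (f y) = E x y.

Definition below (V : Type) (Ln : nat -> set V) (n : nat) : set V :=
  \bigcup_(i < n) Ln i.

(* q n K stands for q^{below Ln n}_K; it is only meaningful when
   K is a subset of below Ln n. *)
Definition labeling (V : Type) (E : rel V) (L : set V)
    (Ln : nat -> set V) (q : nat -> set V -> V) : Prop :=
  [/\ partition [set: nat] Ln L,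
      set_bij [set p : nat * set V | p.2 `<=` below Ln p.1] L
        (fun p => q p.1 p.2),
      forall n, Ln n = [set q n K | K in [set K | K `<=` below Ln n]]
    & forall n K, K `<=` below Ln n -> type_set E L (below Ln n) K (q n K)].

Definition label_le (V : Type) (E : rel V) (L : set V)
    (Ln : nat -> set V) (q : nat -> set V -> V) (x y : V) : Prop :=
  exists m K' n K'',
    [/\ K' `<=` below Ln m /\ x = q m K',
        K'' `<=` below Ln n /\ y = q n K''
      & type_set E L (below Ln m) K' `<=` type_set E L (below Ln n) K''].

Section ReversedTrees.
Variables (V : Type) (le : V -> V -> Prop).
Implicit Types T S : set V.

Definition strict (x y : V) : Prop := le x y /\ x <> y.

Definition above T (x : V) : set V := [set y | T y /\ strict x y].

(* The last clause says that the elements above x are well-ordered by the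
   reverse of le (applied to two-element sets it also gives linearity). *)
Definition reversed_tree T : Prop :=
  [/\ forall x, T x -> le x x,
      forall x y z, T x -> T y -> T z -> le x y -> le y z -> le x z,
      forall x y, T x -> T y -> le x y -> le y x -> x = y
    & forall x, T x -> forall A : set V, A `<=` above T x -> A !=set0 ->
        exists2 m, A m & forall y, A y -> le y m].

(* The elements x of T such that above T x, reversed, has order type n. *)
Definition Lev T (n : nat) : set V :=
  [set x | T x /\ exists2 f : nat -> V, set_bij `I_n (above T x) f &
     forall i j, (i < n)%N -> (j < n)%N -> (i <= j)%N <-> le (f j) (f i)].

Definition height_omega T : Prop :=
  (forall n, Lev T n !=set0) /\ (forall x, T x -> exists n, Lev T n x).

Definition immediate_pred T (t s : V) : Prop :=
  [/\ T t, strict t s & ~ exists u, [/\ T u, strict t u & strict u s]].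

Definition strong_reversed_subtree T S : Prop :=
  [/\ [/\ reversed_tree T, height_omega T & S `<=` T],
      exists! s, S s /\ (forall x, S x -> le x s),
      exists2 n_ : nat -> nat, (forall k, (n_ k < n_ k.+1)%N) &
        forall k, Lev S k !=set0 /\ Lev S k `<=` Lev T (n_ k)
    & forall k s, Lev S k s -> forall t, immediate_pred T t s ->
        exists! st, Lev S k.+1 st /\ le st t].

End ReversedTrees.

Definition monochromatic (V C : Type) (c : V -> C) (S : set V) : Prop :=
  forall x y, S x -> S y -> c x = c y.

(* Main.v *)
(** In a labeling, [q m K'] lies below [q n K''] exactly when [n <= m] and
    [K''] is the trace of [K'] on [below Ln n]: hence [L] is a finitely
    branching tree without terminal nodes, with levels [Ln n].  What remains is
    the one-dimensional Halpern-Lauchli theorem: if the last color is not dense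
    below a node, then by the pigeonhole principle on a finite level that color
    is missing, below some other node, from infinitely many full levels, and the
    number of colors drops.  Below a node where a color is dense, a strong
    subtree of that color is grown level by level. *)

Require Import Defs.
From mathcomp Require Import all_boot.
From mathcomp Require Import boolp classical_sets functions cardinality.

Set Implicit Arguments.
Unset Strict Implicit.
Unset Printing Implicit Defensive.

Local Open Scope classical_set_scope.

(** * Finite and infinite sets *)

Lemma finite_powerset (T : Type) (A : set T) :
  finite_set A -> finite_set [set K | K `<=` A].
Proof.
move=> [n /card_set_bijP[f [fA fI _]]].
pose g (B : {set 'I_n}) := [set x | A x /\ exists2 i, i \in B & f x = val i].
apply: (@sub_finite_set _ _ (range g)); last exact/finite_image/finite_finset.
move=> K /= KA.
exists (finset (fun i : 'I_n => `[< exists2 x, K x & f x = i >])) => //.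
apply/seteqP; split=> [x [Ax [i]]|x Kx]; last first.
  have Ax := KA _ Kx; split=> //; exists (Ordinal (fA _ Ax)) => //.
  by rewrite inE; apply/asboolP; exists x.
rewrite inE => /asboolP[y Ky fy fx].
by rewrite (fI x y) ?inE ?fx //; exact: KA.
Qed.

Lemma set_bij_card_eq (T U : Type) (A : set T) (B : set U) (f : T -> U) :
  set_bij A B f -> card_eq A B.
Proof.
move=> [fS fI fsurj]; have -> : B = f @` A.
  by apply/seteqP; split=> // _ [x Ax <-]; apply: fS.
exact/card_esym/inj_card_eq.
Qed.

Lemma infinite_nat_ge (M : set nat) n :
  infinite_set M -> exists2 m, M m & (n <= m)%N.
Proof.
move=> Minf; apply: contrapT => H; apply: Minf.
apply: (sub_finite_set _ (finite_II n)) => m Mm /=.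
by rewrite ltnNge; apply/negP => nm; apply: H; exists m.
Qed.

(** * Reversed trees presented by their levels *)

(* A family of levels for a poset whose reverse is a tree. *)
Record graded (V : Type) (le : V -> V -> Prop) (A : nat -> set V) : Prop := {
  graded_refl : forall i x, A i x -> le x x;
  graded_anti : forall i j x y, A i x -> A j y -> le x y -> le y x -> x = y;
  graded_mono : forall i j x y, A i x -> A j y -> le x y -> (j <= i)%N;
  graded_chain : forall i j k x y z, A i x -> A j y -> A k z -> (j <= k)%N ->
    le x y -> le x z -> le z y;
  graded_up : forall i j x, A i x -> (j <= i)%N -> exists2 y, A j y & le x y }.

Section Graded.
Context {V : Type} {le : V -> V -> Prop} {A : nat -> set V}.
Hypothesis gA : graded le A.

Lemma graded_inj i j x : A i x -> A j x -> i = j.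
Proof.
move=> Ai Aj; have xx := graded_refl gA Ai.
by apply/eqP; rewrite eqn_leq (graded_mono gA Ai Aj xx)
  (graded_mono gA Aj Ai xx).
Qed.

Lemma graded_unique i j x y z :
  A i x -> A j y -> A j z -> le x y -> le x z -> y = z.
Proof.
move=> Ax Ay Az xy xz.
by apply: (graded_anti gA Ay Az);
  [exact: (graded_chain gA Ax Az Ay)|exact: (graded_chain gA Ax Ay Az)].
Qed.

Lemma graded_strict i j x y : A i x -> A j y -> strict le x y -> (j < i)%N.
Proof.
move=> Ax Ay [xy nxy].
rewrite ltn_neqAle (graded_mono gA Ax Ay xy) andbT; apply/eqP => ji.
by apply: nxy; subst j; apply: (graded_unique Ax Ax Ay) => //;
  exact: (graded_refl gA Ax).
Qed.

(** A point of [A n] has exactly one point above it on each level [i < n]; listing these by level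
    gives the required enumeration. *)
Lemma graded_sub_Lev n : A n `<=` Lev le (\bigcup_i A i) n.
Proof.
move=> x Ax; split; first by exists n.
have /choice[f fP] : forall i, exists y, (i < n)%N -> A i y /\ le x y.
  move=> i; have [ltin|_] := ltnP i n; last by exists x.
  by have [y] := graded_up gA Ax (ltnW ltin); exists y.
exists f; first split.
- move=> i /= ltin; have [Af xf] := fP _ ltin; split; first by exists i.
  split=> // xE; move: ltin.
  by rewrite -xE in Af; rewrite (graded_inj Ax Af) ltnn.
- move=> i j; rewrite !inE /= => ltin ltjn fE.
  have [Ai _] := fP _ ltin; have [Aj _] := fP _ ltjn.
  by rewrite -fE in Aj; apply: graded_inj Ai Aj.
- move=> y [[i _ Ay] xy]; have ltin := graded_strict Ax Ay xy.
  exists i => //=; have [Af xf] := fP _ ltin.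
  by apply: (graded_unique Ax Af Ay) => //; case: xy.
move=> i j ltin ltjn; have [Ai xi] := fP _ ltin; have [Aj xj] := fP _ ltjn.
split=> [ij|]; first exact: (graded_chain gA Ax Ai Aj).
exact: (graded_mono gA Aj Ai).
Qed.

Lemma graded_Lev n : Lev le (\bigcup_i A i) n = A n.
Proof.
apply/seteqP; split=> [x Lx|]; last exact: graded_sub_Lev.
(* If [x] lies in [A m], the points strictly above it are in bijection with both [I_n] and [I_m]. *)
case: (Lx) => -[m _ Ax] [f fn _]; have [_ [g gm _]] := graded_sub_Lev Ax.
suff /card_eq_II -> : card_eq `I_n `I_m by [].
exact: card_eq_trans (set_bij_card_eq fn) (card_esym (set_bij_card_eq gm)).
Qed.

Lemma graded_reversed_tree :
  (forall x y z, le x y -> le y z -> le x z) ->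
  reversed_tree le (\bigcup_i A i).
Proof.
move=> le_trans; split.
- by move=> x [i _ Ax]; apply: (graded_refl gA Ax).
- by move=> x y z _ _ _; apply: le_trans.
- by move=> x y [i _ Ax] [j _ Ay]; apply: (graded_anti gA Ax Ay).
move=> x [i _ Ax] B BS [b0 Bb0].
(* All of [B] lies above [x], hence is a chain ordered by level; its greatest element sits on the
   smallest level it meets. *)
have exB : exists n, `[< exists2 b, B b & A n b >].
  by have [[j _ Ab] _] := BS _ Bb0; exists j; apply/asboolP; exists b0.
case: (ex_minnP exB) => n /asboolP[b Bb Ab] nmin; exists b => // y By.
have [[j _ Ay] [xy _]] := BS _ By; have [_ [xb _]] := BS _ Bb.
apply: (graded_chain gA Ax Ab Ay) => //.
by apply: nmin; apply/asboolP; exists y.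
Qed.

Lemma graded_height_omega :
  (forall n, A n !=set0) -> height_omega le (\bigcup_i A i).
Proof.
move=> A0; split=> [n|x [n _ Ax]]; first by rewrite graded_Lev.
by exists n; rewrite graded_Lev.
Qed.

Lemma graded_immediate_pred n s t :
  A n s -> immediate_pred le (\bigcup_i A i) t s -> A n.+1 t /\ le t s.
Proof.
move=> As [[m _ At] ts noint]; split; last by case: ts.
have [u Au tu] := graded_up gA At (graded_strict At As ts).
have [->//|ntu] := pselect (t = u); case: noint; exists u.
split; [by exists n.+1|by []|split].
  by apply: (graded_chain gA At As Au) => //; case: ts.
by move=> us; rewrite us in Au; have := graded_inj As Au => /n_Sn.
Qed.

End Graded.

(** * One-dimensional Halpern-Lauchli theorem *)

Section HalpernLauchli.
Context {V : Type} {le : V -> V -> Prop} {A : nat -> set V}.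
Hypothesis gA : graded le A.
Hypothesis le_trans : forall x y z, le x y -> le y z -> le x z.
Hypothesis A_fin : forall n, finite_set (A n).
Hypothesis A_down : forall n x, A n x -> exists2 y, A n.+1 y & le y x.

(** One level [m] must serve all nodes of level [n] below [t] at once: a level of the strong subtree
    has to lie inside a single level of the tree. *)
Definition dense_below (P : set V) (t : V) : Prop :=
  forall n, exists2 m, (n <= m)%N &
    forall x, A n x -> le x t -> exists y, [/\ A m y, le y x & P y].

Lemma graded_down n m x : A n x -> (n <= m)%N -> exists2 y, A m y & le y x.
Proof.
move=> Ax; elim: m => [|m IH].
  by rewrite leqn0 => /eqP n0; exists x; rewrite -?n0 //;
     apply: (graded_refl gA Ax).
rewrite leq_eqVlt => /orP[/eqP <-|/IH[y Ay yx]].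
  by exists x => //; apply: (graded_refl gA Ax).
by have [z Az zy] := A_down Ay; exists z => //; apply: le_trans zy yx.
Qed.

(* M restricts the levels on which the coloring is controlled; it shrinks each
   time a color is discarded. *)
Lemma dense_color (c : V -> nat) k : forall (M : set nat) n t,
  A n t -> infinite_set M ->
  (forall m x, M m -> A m x -> le x t -> (c x < k)%N) ->
  exists i t' n', A n' t' /\ dense_below [set x | c x = i] t'.
Proof.
elim: k => [|k IH] M n t At Minf cM.
  have [m Mm nm] := infinite_nat_ge n Minf.
  by have [y Ay yt] := graded_down At nm; have := cM _ _ Mm Ay yt.
have [D|] := pselect (dense_below [set x | c x = k] t).
  by exists k, t, n.
move=> /existsNP[p /forall2NP Dn].
(* [W x] collects the levels in [M] on which color [k] is missing below [x]; if it is infinite, it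
   replaces [M] and [x] replaces [t]. *)
pose W x := [set m | M m /\ forall y, A m y -> le y x -> c y <> k].
have [[x [Ax xt] Wx]|noW] :=
    pselect (exists2 x, A p x /\ le x t & infinite_set (W x)).
  apply: (IH (W x) p x Ax Wx) => m y [Mm Hm] Ay yx.
  have := cM _ _ Mm Ay (le_trans yx xt); rewrite ltnS leq_eqVlt.
  by move=> /orP[/eqP /(Hm _ Ay yx)|].
(* Every level of [M] from [p] on is in [W x] for some [x] in the finite set [B], so finite sets
   [W x] would make [M] finite. *)
case: Minf; pose B := [set x | A p x /\ le x t].
apply: (@sub_finite_set _ _ (`I_p `|` \bigcup_(x in B) W x)).
  move=> m Mm; have [?|pm] := ltnP m p; [by left|right].
  have [//|/existsNP[x /not_implyP[Ax /not_implyP[xt nx]]]] := Dn m.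
  exists x => //; split=> // y Ay yx cy; apply: nx; exists y; split=> //.
rewrite finite_setU; split=> //; apply: bigcup_finite.
  by apply: sub_finite_set (A_fin p) => x [].
by move=> x Bx; apply: contrapT => Wx; apply: noW; exists x.
Qed.

Lemma dense_strong_subtree (P : set V) n t : A n t -> dense_below P t ->
  (forall n, A n !=set0) ->
  exists2 S, strong_reversed_subtree le (\bigcup_i A i) S & S `<=` P.
Proof.
move=> At tP A0.
have /choice[nx nxP] : forall n, exists m, (n <= m)%N /\
    forall x, A n x -> le x t -> exists y, [/\ A m y, le y x & P y].
  by move=> p; have [m] := tP p; exists m.
(* [ext x] is a point of [P] below [x], on the level [nx m] assigned to the level [m] of [x]. *)
have /choice[ext extP] : forall x, exists y, forall m, A m x -> le x t ->
    [/\ A (nx m) y, le y x & P y].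
  move=> x; have [[m [Ax xt]]|no] := pselect (exists m, A m x /\ le x t).
    have [y Hy] := (nxP m).2 x Ax xt; exists y => m' Ax' _.
    by rewrite (graded_inj gA Ax' Ax).
  by exists x => m Ax xt; case: no; exists m.
(* [S_ k] lies on level [lv k]. Each node on level [(lv k).+1] below a point of [S_ k] contributes a
   single extension to [S_ k.+1]. *)
pose lv := fix lv k := if k is k'.+1 then nx (lv k').+1 else nx n.
pose S_ := fix S_ k : set V := if k is k'.+1 then
  [set ext u | u in [set u | A (lv k').+1 u /\ exists2 s, S_ k' s & le u s]]
  else [set ext t].
have tt := graded_refl gA At.
have SP k x : S_ k x -> [/\ A (lv k) x, le x t & P x].
  elim: k x => [x /= ->|k IH x /= [u [Au [s Ss us]] <-]].
    exact: extP At tt.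
  have [_ st _] := IH _ Ss; have ut := le_trans us st.
  by have [? eu ?] := extP _ _ Au ut; split=> //; apply: le_trans eu ut.
have lvS k : (lv k < lv k.+1)%N by exact: (nxP _).1.
have lv_mono : {mono lv : i j / (i <= j)%N}.
  by apply: leq_mono; apply: homo_ltn => //; apply: ltn_trans.
have up1 k x : S_ k.+1 x -> exists2 y, S_ k y & le x y.
  move=> /= [u [Au [s Ss us]] <-]; exists s => //.
  have [_ st _] := SP _ _ Ss.
  have [_ eu _] := extP _ _ Au (le_trans us st).
  exact: le_trans eu us.
(* As [lv] is strictly increasing, [S_] inherits the grading, so its levels in the induced order are
   the sets [S_ k]. *)
have gS : graded le S_.
  split.
  - by move=> i x /SP[Ax _ _]; apply: (graded_refl gA Ax).
  - by move=> i j x y /SP[Ax _ _] /SP[Ay _ _]; apply: (graded_anti gA Ax Ay).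
  - move=> i j x y /SP[Ax _ _] /SP[Ay _ _] xy.
    by rewrite -lv_mono (graded_mono gA Ax Ay).
  - move=> i j k x y z /SP[Ax _ _] /SP[Ay _ _] /SP[Az _ _].
    by rewrite -lv_mono; apply: (graded_chain gA Ax Ay Az).
  - move=> i j; elim: i => [|i IH] x Sx.
      rewrite leqn0 => /eqP ->; exists x => //.
      by have [Ax _ _] := SP _ _ Sx; apply: (graded_refl gA Ax).
    rewrite leq_eqVlt => /orP[/eqP ->|].
      by exists x => //; have [Ax _ _] := SP _ _ Sx; apply: (graded_refl gA Ax).
    rewrite ltnS => ji; have [y Sy xy] := up1 _ _ Sx.
    by have [z Sz yz] := IH _ Sy ji; exists z => //; apply: le_trans xy yz.
exists (\bigcup_i S_ i); last by move=> x [i _ /SP[]].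
split.
- split; [exact: graded_reversed_tree|exact: graded_height_omega|].
  by move=> x [i _ /SP[Ax _ _]]; exists (lv i).
- have top x : (\bigcup_i S_ i) x -> le x (ext t).
    by move=> [i _ Sx]; have [y /= -> ] := graded_up gS Sx (leq0n i).
  have S0 : (\bigcup_i S_ i) (ext t) by exists 0%N.
  exists (ext t); split=> // s [Ss smax].
  case: (Ss) => i _ Si.
  by apply: (@graded_anti _ _ _ gS 0 i) => //; [exact: smax|exact: top].
- exists lv => // k; rewrite !(graded_Lev gA, graded_Lev gS); split.
    elim: k => [|k [s Ss]]; first by exists (ext t).
    have [As _ _] := SP _ _ Ss; have [u Au us] := A_down As.
    by exists (ext u), u => //; split=> //; exists s.
  by move=> x /SP[].
move=> k s; rewrite !(graded_Lev gS) => Ss u.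
have [As st _] := SP _ _ Ss => /(graded_immediate_pred gA As)[Au us].
have ut := le_trans us st; have [Ae eu _] := extP _ _ Au ut.
exists (ext u); split=> [|x [Sx xu]].
  by split=> //; exists u => //; split=> //; exists s.
(* Uniqueness: [x] is [ext v] with [v] on the level of [u]; both are above [x], so [v = u]. *)
have [Ax _ _] := SP _ _ Sx; case: Sx => v [Av [s' Ss' vs']] vx.
have [_ s't _] := SP _ _ Ss'.
have [_ ev _] := extP _ _ Av (le_trans vs' s't); rewrite vx in ev.
by rewrite -vx (graded_unique gA Ax Au Av).
Qed.

Lemma monochromatic_strong_subtree r (c : V -> 'I_r) :
  (forall n, A n !=set0) ->
  exists S, strong_reversed_subtree le (\bigcup_i A i) S /\ monochromatic c S.
Proof.
move=> A0; have [t At] := A0 0%N.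
have [||i [t' [n' [At' D]]]] :=
    @dense_color (fun x => c x) r [set: nat] 0%N t At.
- exact: infinite_nat.
- by move=> m x _ _ _; apply: ltn_ord.
have [S stS SP] := dense_strong_subtree At' D A0.
by exists S; split=> // x y /SP /= cx /SP /= cy; apply: val_inj; rewrite /= cx.
Qed.

End HalpernLauchli.

(** * The tree order of a labeling *)

Section Labeling.
Context {V : Type} {E : rel V} {L : set V} {Ln : nat -> set V}
  {q : nat -> set V -> V}.
Hypothesis hq : labeling E L Ln q.

Lemma subset_below m n : (m <= n)%N -> below Ln m `<=` below Ln n.
Proof. by move=> mn x [i /= im Lx]; exists i => //=; apply: leq_trans mn. Qed.

Lemma label_type_subset m K' n K'' :
  K' `<=` below Ln m -> K'' `<=` below Ln n ->
  (type_set E L (below Ln m) K' `<=` type_set E L (below Ln n) K'') <->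
  (n <= m)%N /\ K'' = K' `&` below Ln n.
Proof.
case: hq => _ _ LnE qP K'm K''n; split=> [sub|[nm ->]]; last first.
  move=> v [Lv nb EK nEK]; split=> //.
  - by move=> /(subset_below nm).
  - by move=> k [/EK].
  move=> h [hn nh]; apply: nEK; split; first exact: subset_below hn.
  by move=> K'h; apply: nh.
(* The point [q m K'] realizes both types. It would lie in [below Ln n] if [m < n], and its
   neighbors there determine [K'']. *)
have [Lq nb EK nEK] := qP _ _ K'm.
have [_ nb' EK' nEK'] := sub _ (qP _ _ K'm).
have nm : (n <= m)%N.
  rewrite leqNgt; apply/negP => mn; apply: nb'; exists m => //.
  by rewrite LnE; exists K'.
split=> //; apply/seteqP; split=> [x K''x|x [K'x xn]].
  split; last exact: K''n.
  apply: contrapT => nK'x; have := EK' _ K''x; apply/negP.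
  by apply: nEK; split=> //; apply: subset_below nm _ _; apply: K''n.
apply: contrapT => nK''x; have := EK _ K'x; apply/negP.
by apply: nEK'; split.
Qed.

(** Injectivity of [q] makes the pairs quantified in [label_le] the given ones. *)
Lemma label_leP m K' n K'' :
  K' `<=` below Ln m -> K'' `<=` below Ln n ->
  label_le E L Ln q (q m K') (q n K'') <->
  (n <= m)%N /\ K'' = K' `&` below Ln n.
Proof.
move=> K'm K''n; rewrite -label_type_subset //.
split=> [|sub]; last by exists m, K', n, K''.
case: hq => _ [_ qI _] _ _.
move=> [m1 [K1 [n1 [K2 [[K1m e1] [K2n e2] sub]]]]].
have := qI (m, K') (m1, K1); rewrite !inE /= => /(_ K'm K1m e1) [-> ->].
by have := qI (n, K'') (n1, K2); rewrite !inE /= => /(_ K''n K2n e2) [-> ->].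
Qed.

Lemma label_levelP n x :
  Ln n x -> exists2 K, K `<=` below Ln n & x = q n K.
Proof. by case: hq => _ _ -> _ [K Kn <-]; exists K. Qed.

Lemma label_level n K : K `<=` below Ln n -> Ln n (q n K).
Proof. by move=> Kn; case: hq => _ _ -> _; exists K. Qed.

Lemma label_le_trans x y z : label_le E L Ln q x y -> label_le E L Ln q y z ->
  label_le E L Ln q x z.
Proof.
move=> [m [K1 [n [K2 [[K1m e1] [K2n e2] s1]]]]].
move=> [n' [K3 [p [K4 [[K3n e3] [K4p e4] s2]]]]].
exists m, K1, p, K4; split=> //; apply: subset_trans s1 _.
case: hq => _ [_ qI _] _ _; have := qI (n, K2) (n', K3).
by rewrite !inE /= -e2 -e3 => /(_ K2n K3n erefl) [-> ->].
Qed.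

Lemma finite_label_level n : finite_set (Ln n).
Proof.
elim/ltn_ind: n => n IH; case: hq => _ _ -> _.
by apply/finite_image/finite_powerset/bigcup_finite.
Qed.

Lemma label_graded : graded (label_le E L Ln q) Ln.
Proof.
split.
- move=> i x /label_levelP[K Ki ->]; rewrite label_leP //.
  by split=> //; rewrite setIidl.
- move=> i j x y /label_levelP[K Ki ->] /label_levelP[K' K'j ->].
  rewrite !label_leP // => -[ji _] [ij ->].
  have ij' : i = j by apply/eqP; rewrite eqn_leq ij ji.
  by rewrite ij' setIidl.
- move=> i j x y /label_levelP[K Ki ->] /label_levelP[K' K'j ->].
  by rewrite label_leP // => -[].
- move=> i j k x y z /label_levelP[K Ki ->] /label_levelP[K' K'j ->].
  move=> /label_levelP[K'' K''k ->] jk; rewrite !label_leP // => -[_ ->] [_ ->].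
  (* Taking traces on [below Ln k] and then on [below Ln j] amounts to taking the trace on
     [below Ln j]. *)
  by split=> //; rewrite -setIA (setIidr (subset_below jk)).
- move=> i j x /label_levelP[K Ki ->] ji; exists (q j (K `&` below Ln j)).
    exact: label_level.
  by rewrite label_leP.
Qed.

Lemma label_down n x :
  Ln n x -> exists2 y, Ln n.+1 y & label_le E L Ln q y x.
Proof.
move=> /label_levelP[K Kn ->].
have Kn1 : K `<=` below Ln n.+1.
  by apply: subset_trans Kn _; apply: subset_below.
(* The same [K], read on the next level, has trace [K] on [below Ln n]. *)
exists (q n.+1 K); first exact: label_level.
by rewrite label_leP //; split=> //; rewrite setIidl.
Qed.

End Labeling.

Theorem theorem9p2 (V : Type) (E : rel V) (hR : rado_graph E)
    (L : set V) (hL : copy E L)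
    (Ln : nat -> set V) (q : nat -> set V -> V) (hq : labeling E L Ln q)
    (r : nat) (c : V -> 'I_r) :
  exists S : set V,
    strong_reversed_subtree (label_le E L Ln q) L S /\ monochromatic c S.
Proof.
case: (hq) => -[LE _ Ln0] _ _ _.
have := monochromatic_strong_subtree (label_graded hq) (label_le_trans hq)
  (finite_label_level hq) (label_down hq) c (fun n => Ln0 n I).
by rewrite -/(cover _ _) LE.
Qed.
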